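(* Let $\Phi$ be an irreducible root system in a Euclidean space $V$, and let $L(\Phi)$ be its root lattice. Define $$\mathcal{E}(\Phi):=\left\{\text{exponent of the finite abelian group }\frac{L(\Phi)}{\operatorname{Span}_{\mathbb{Z}}S}\ \middle|\ S\subset\Phi\text{ such that }\operatorname{Span}_{\mathbb{R}}S=V\right\}\subset\mathbb{N}.$$ Then $\mathcal{E}(\Phi)=\mathcal{H}(\Phi)\cup\{1\}$.
   Context: Root systems are finite, reduced and crystallographic, and span $V$. The root lattice $L(\Phi)$ is the $\mathbb{Z}$-span of $\Phi$ (equivalently of a base of simple roots). The exponent of a group is the smallest positive integer that annihilates the group. $\mathcal{H}(\Phi)\subset\mathbb{N}$ is the set of coefficients that occur when the highest root of $\Phi$ is written in terms of simple roots. *)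

(* Defs.v *)
From HB Require Import structures.
From mathcomp Require Import all_boot all_order all_algebra finmap.
From mathcomp Require Import boolp classical_sets reals.

Set Implicit Arguments.
Unset Strict Implicit.
Unset Printing Implicit Defensive.

Import GRing.Theory Num.Theory.

Local Open Scope ring_scope.
Local Open Scope fset_scope.

(* MathComp's [exponent] is defined for finite multiplicative groups only. *)
Definition is_exponent (A : zmodType) (n : nat) : Prop :=
  [/\ (0 < n)%N,
      forall x : A, x *+ n = 0
    & forall m : nat, (0 < m)%N -> (forall x : A, x *+ m = 0) -> (n <= m)%N].

Section IntegralSpan.
Variable V : zmodType.
Implicit Type S T : {fset V}.

Definition intspan S : {pred V} := fun v => `[< inIntSpan (in_tuple S) v >].

Fact intspan_zmod_closed S : zmod_closed (intspan S).
Proof.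
split=> [|x y /asboolP[a ->] /asboolP[b ->]]; apply/asboolP.
  by exists [ffun=> 0]; rewrite big1 // => i _; rewrite ffunE mulr0z.
exists [ffun i => a i - b i]; rewrite -sumrB.
by apply: eq_bigr => i _; rewrite ffunE mulrzBr.
Qed.

HB.instance Definition _ S :=
  GRing.isZmodClosed.Build V (intspan S) (intspan_zmod_closed S).

Record lattice S := Lattice { lattice_val :> V; _ : lattice_val \in intspan S }.

HB.instance Definition _ S := [isSub for @lattice_val S].
HB.instance Definition _ S := [Choice of lattice S by <:].
HB.instance Definition _ S := [SubChoice_isSubZmodule of lattice S by <:].

Definition sublattice T S : {pred lattice T} := fun x => val x \in intspan S.
Arguments sublattice : clear implicits.

Fact sublattice_zmod_closed T S : zmod_closed (sublattice T S).
Proof.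
split=> [|x y]; first exact: (rpred0 (intspan S)).
exact: (@rpredB _ (intspan S) (val x) (val y)).
Qed.

HB.instance Definition _ T S :=
  GRing.isZmodClosed.Build (lattice T) (sublattice T S)
    (sublattice_zmod_closed T S).

(* The quotient of Span_Z T by its intersection with Span_Z S; it is
   Span_Z T / Span_Z S when S is a subset of T. *)
Definition lattice_quot T S : zmodType := Quotient.quot (sublattice T S).

End IntegralSpan.

Arguments sublattice {V} T S _.

Section RootSystem.
Variables (R : realType) (V : vectType R) (dot : {dot V for @idfun R}).
Implicit Types (Phi D S : {fset V}) (theta : V).

Definition reflection (a v : V) : V := v - (2 * dot v a / dot a a) *: a.

Definition is_root_system Phi : Prop :=
  [/\ <<Phi>>%VS = fullv,
      0 \notin Phi,
      {in Phi, forall a (c : R), c *: a \in Phi -> c = 1 \/ c = -1},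
      {in Phi &, forall a b, reflection a b \in Phi}
    & {in Phi &, forall a b, 2 * dot b a / dot a a \is a Num.int}].

Definition is_irreducible Phi : Prop :=
  Phi != fset0 /\
  forall A B : {fset V}, A `|` B = Phi ->
    {in A & B, forall a b, dot a b = 0} -> A = fset0 \/ B = fset0.

Definition natspan D (v : V) : Prop :=
  exists c : V -> nat, v = \sum_(a <- D) a *+ c a.

Definition is_base Phi D : Prop :=
  [/\ D `<=` Phi,
      basis_of fullv D
    & {in Phi, forall b, natspan D b \/ natspan D (- b)}].

Definition is_highest_root Phi D theta : Prop :=
  theta \in Phi /\ {in Phi, forall b, natspan D (theta - b)}.

(* All bases of an irreducible root system yield the same coefficients. *)
Definition highest_coeffs Phi : set nat :=
  [set m | exists D theta (c : V -> nat),
     [/\ is_base Phi D, is_highest_root Phi D theta,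
         theta = \sum_(a <- D) a *+ c a
       & exists2 a, a \in D & m = c a]]%classic.

Definition exponents Phi : set nat :=
  [set e | exists S : {fset V},
     [/\ (S `<=` Phi)%fset, <<S>>%VS = fullv & is_exponent (lattice_quot Phi S) e]]%classic.

End RootSystem.

(* Main.v *)
Require Import Defs.
From HB Require Import structures.
From mathcomp Require Import all_boot all_order all_algebra finmap.
From mathcomp Require Import boolp classical_sets reals.
From mathcomp Require Import zify ring lra.

(** The exponent of a finite abelian group is the largest order of its
    characters, and the characters of [L / Span_Z S] are the points of [V]
    that take integral values on [S], taken modulo the points that are integral
    on all roots.  Here a point is a linear functional [f] on [V].

    A point may be moved into the fundamental alcove.  Translating by the coroot
    of a root [b] with [f b > 1] keeps [f] the same modulo integers and
    decreases the invariant quadratic form [sum_a (f a)^2]; as [f] has bounded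
    denominators, this ends with [f <= 1] on all roots (alcove_translate).
    A base is then chosen on which [f >= 0] (regular_base), so that
    [0 <= f <= f t <= 1] on positive roots, for [t] the highest root.

    A root in [S] takes one of the values 0, 1, -1 on [f]; it is then supported
    on the simple roots with [f = 0], or it is, up to sign, [t] minus such
    a combination.  As [S] spans [V], at most one simple root [a] has [f a <> 0]:
    either [f = 0], or [f t = 1] and [f a = 1 / c], where [c] is the coefficient
    of [a] in [t] (alcove_vertex).  The order of the character is thus 1 or [c].

    Conversely, the simple roots other than [a], together with [t], generate
    a lattice [L'] with [L / L'] cyclic of order [c] (highest_coeff_exponent),
    and [S = Phi] gives the exponent 1.

    A character whose order is the exponent comes from the Smith normal form of
    the coordinates of [S] in a base: it is the last coordinate of the adapted
    basis divided by the last invariant factor (smith_character,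
    exists_character).  The existence of a base on which a given functional is
    nonnegative (exists_regular, exists_base) and of a highest root
    (exists_highest_root) are proved on the way. *)

Set Implicit Arguments.
Unset Strict Implicit.
Unset Printing Implicit Defensive.

Import Order.TTheory GRing.Theory Num.Theory.

Local Open Scope ring_scope.

(** * Integral spans and the exponent of a lattice quotient *)

Section IntegralSpans.
Variable V : zmodType.
Implicit Types (S T : {fset V}) (v : V).

Lemma intspanP S v :
  reflect (exists z : V -> int, v = \sum_(a <- S) a *~ z a) (v \in intspan S).
Proof.
apply: (iffP (asboolP _)) => [[c ->]|[z ->]]; last first.
  exists [ffun i : 'I_(size S) => z S`_i].
  by rewrite (big_nth 0) big_mkord; apply: eq_bigr => i _; rewrite ffunE.
pose c' (k : nat) := if insub k is Some i then c i else 0.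
exists (fun a => c' (index a S)).
rewrite (big_nth 0) big_mkord; apply: eq_bigr => i _ /=.
by rewrite index_uniq ?fset_uniq // /c' valK.
Qed.

Lemma intspan_gen S a : a \in S -> a \in intspan S.
Proof.
move=> aS; apply/intspanP; exists (fun b => (b == a)%:Z).
rewrite (bigD1_seq a) ?fset_uniq //= eqxx mulr1z big1 ?addr0 // => b /negPf ->.
by rewrite mulr0z.
Qed.

Lemma lattice_quot_eq0 T S (u : lattice T) :
  (\pi_(lattice_quot T S) u == 0)%qT = (val u \in intspan S).
Proof.
by rewrite -[RHS]/(u \in sublattice T S) -[u in RHS]subr0 Quotient.idealrBE !piE.
Qed.

Lemma lattice_quotMn T S (u : lattice T) n :
  (\pi_(lattice_quot T S) (u *+ n) = \pi u *+ n)%qT.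
Proof.
elim: n => [|n IH]; first by apply/eqP; rewrite mulr0n lattice_quot_eq0 rpred0.
by rewrite !mulrS -IH; exact: Quotient.pi_add.
Qed.

Lemma lattice_quot_annulP T S n :
  (forall x : lattice_quot T S, x *+ n = 0) <->
  {in T, forall a, a *+ n \in intspan S}.
Proof.
split=> [h a aT|h x].
  pose u : lattice T := Lattice (intspan_gen aT).
  have := h (\pi_(lattice_quot T S) u)%qT.
  by rewrite -lattice_quotMn => /eqP; rewrite lattice_quot_eq0 raddfMn.
rewrite -[x]reprK -lattice_quotMn; apply/eqP; rewrite lattice_quot_eq0.
(* [x] is the class of some [v] in the span of [T] *)
case: (repr x) => v vT; rewrite raddfMn /=; have /intspanP[z ->] := vT.
rewrite -sumrMnl big_seq rpred_sum // => a aT.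
by rewrite pmulrn mulrzAC -pmulrn rpredMz ?h.
Qed.
End IntegralSpans.

(** * Roots, reflections and Cartan integers *)

Section RootBasics.
Variables (R : realType) (V : vectType R) (dot : {dot V for @idfun R}).
Implicit Types (u v w a b : V) (D : {fset V}) (f : 'Hom(V, R^o)).

Lemma dotC u v : dot u v = dot v u.
Proof. by rewrite hermC expr0 mul1r. Qed.

Lemma dot_gt0 u : u != 0 -> 0 < dot u u.
Proof. exact: neq0_dnorm_gt0. Qed.

Lemma dot_ge0 u : 0 <= dot u u.
Proof.
by have [->|/dot_gt0/ltW//] := eqVneq u 0; rewrite linear0l.
Qed.

(** The form as a function of its left argument, the side on which it is
    declared linear below. *)
Definition dotl a : V -> R^o := fun v => dot v a.

Fact dotl_is_linear a : linear (dotl a).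
Proof. by move=> k u v; rewrite /dotl linearDl linearZl_LR. Qed.

HB.instance Definition _ a :=
  GRing.isLinear.Build R V R^o *:%R (dotl a) (dotl_is_linear a).

(** The coroot of [a] as a functional: on roots it gives the Cartan integers. *)
Definition cartan a : 'Hom(V, R^o) := linfun (dotl ((2 / dot a a) *: a)).

Lemma cartanE a v : cartan a v = 2 * dot v a / dot a a.
Proof. by rewrite lfunE /= /dotl linearZr_LR /=; ring. Qed.

Lemma reflectionE a v : reflection dot a v = v - cartan a v *: a.
Proof. by rewrite cartanE. Qed.

Lemma cartan_id a : a != 0 -> cartan a a = 2.
Proof. by move/dot_gt0 => a0; rewrite cartanE mulfK // gt_eqF. Qed.

Lemma homZ f c v : f (c *: v) = c * f v :> R.
Proof. by rewrite linearZ. Qed.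

Lemma homMn f v n : f (v *+ n) = f v *+ n :> R.
Proof. by rewrite raddfMn. Qed.

Lemma homD f u v : f (u + v) = f u + f v :> R.
Proof. by rewrite raddfD. Qed.

Lemma homN f v : f (- v) = - f v :> R.
Proof. by rewrite raddfN. Qed.

Lemma homB f u v : f (u - v) = f u - f v :> R.
Proof. by rewrite raddfB. Qed.

Lemma reflectionK a : a != 0 -> involutive (reflection dot a).
Proof.
move=> a0 v; rewrite !reflectionE homB homZ cartan_id // -addrA -opprD -scalerDl.
by rewrite [X in X *: a](_ : _ = 0%R) ?scale0r ?subr0 //; ring.
Qed.

Lemma natspan0 D : natspan D 0.
Proof. by exists (fun=> 0%N); rewrite big1. Qed.

Lemma natspan_gen D a : a \in D -> natspan D a.
Proof.
move=> aD; exists (fun b => nat_of_bool (b == a)).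
by rewrite (bigD1_seq a) ?fset_uniq //= eqxx big1 ?addr0 // => b /negPf ->.
Qed.

Lemma natspanD D u v : natspan D u -> natspan D v -> natspan D (u + v).
Proof.
move=> [c ->] [d ->]; exists (fun a => (c a + d a)%N).
by rewrite -big_split; apply: eq_bigr => a _; rewrite mulrnDr.
Qed.

Lemma natspan_ge0 f D v : {in D, forall a, 0 <= f a} -> natspan D v -> 0 <= f v.
Proof.
move=> f0 [c ->]; rewrite linear_sum big_seq sumr_ge0 // => a aD.
by rewrite linearMn mulrn_wge0 ?f0.
Qed.

Lemma dotDl u v w : dot (u + v) w = dot u w + dot v w.
Proof. exact: linearDl. Qed.

Lemma dotZl k u v : dot (k *: u) v = k * dot u v.
Proof. exact: linearZl_LR. Qed.

Lemma dot_suml (r : seq V) (E : V -> V) v :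
  dot (\sum_(a <- r) E a) v = \sum_(a <- r) dot (E a) v.
Proof. exact: linear_sumlz. Qed.

Lemma natspan_orthogonal D D' u v :
    {in D & D', forall a b, dot a b = 0} -> natspan D u -> natspan D' v ->
  dot u v = 0.
Proof.
move=> orth [c ->] [d ->]; rewrite linear_sumlz big_seq big1 // => a aD.
rewrite linear_sumr big_seq big1 // => b bD'.
by rewrite linearMnl linearMnr /= orth // !mul0rn.
Qed.

Variable Phi : {fset V}.
Hypothesis rsPhi : is_root_system dot Phi.

Lemma root_neq0 a : a \in Phi -> a != 0.
Proof. by case: rsPhi => _ n0 _ _ _ aP; apply: contraNneq n0 => <-. Qed.

Lemma root_reflection a b : a \in Phi -> b \in Phi -> b - cartan a b *: a \in Phi.
Proof. by case: rsPhi => _ _ _ h _ aP bP; rewrite -reflectionE h. Qed.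

Lemma cartan_int a b : a \in Phi -> b \in Phi -> cartan a b \is a Num.int.
Proof. by case: rsPhi => _ _ _ _ h aP bP; rewrite cartanE h. Qed.

Lemma root_opp a : a \in Phi -> - a \in Phi.
Proof.
move=> aP; have := root_reflection aP aP.
by rewrite cartan_id ?root_neq0 // scaler_nat mulr2n opprD addrA subrr sub0r.
Qed.

(** If one of the two Cartan integers is 1, a reflection produces
    [a - b] or its opposite.  Both are positive, so otherwise both are at least 2,
    which makes [dot a b] at least both squared norms and forces [a = b]. *)
Lemma root_sub a b :
  a \in Phi -> b \in Phi -> a != b -> 0 < dot a b -> a - b \in Phi.
Proof.
move=> aP bP neq_ab ab_gt0.
have a0 := dot_gt0 (root_neq0 aP); have b0 := dot_gt0 (root_neq0 bP).
have ca_gt0 : 0 < cartan a b.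
  by rewrite cartanE dotC divr_gt0 ?mulr_gt0 ?ltr0n.
have cb_gt0 : 0 < cartan b a by rewrite cartanE divr_gt0 ?mulr_gt0 ?ltr0n.
have [ca1|nca1] := eqVneq (cartan a b : R) 1.
  by rewrite -opprB root_opp //; have := root_reflection aP bP; rewrite ca1 scale1r.
have [cb1|ncb1] := eqVneq (cartan b a : R) 1.
  by have := root_reflection bP aP; rewrite cb1 scale1r.
have int_ge2 (x : R) : x \is a Num.int -> 0 < x -> x != 1 -> 2 <= x.
  move=> /intrP[z ->]; rewrite ltr0z => z0.
  by rewrite (eqr_int R z 1) (ler_int R 2 z); lia.
have ca2 := int_ge2 _ (cartan_int aP bP) ca_gt0 nca1.
have cb2 := int_ge2 _ (cartan_int bP aP) cb_gt0 ncb1.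
have {ca2} aab : dot a a <= dot a b.
  by move: ca2; rewrite cartanE dotC ler_pdivlMr // ler_pM2l.
have {cb2} bab : dot b b <= dot a b.
  by move: cb2; rewrite cartanE ler_pdivlMr // ler_pM2l.
have: dot (a - b) (a - b) <= 0.
  by rewrite !(linearBl, linearBr) /= (dotC b a); lra.
by rewrite leNgt dot_gt0 // subr_eq0.
Qed.

Lemma root_add a b :
  a \in Phi -> b \in Phi -> a + b != 0 -> dot a b < 0 -> a + b \in Phi.
Proof.
move=> aP bP ab0 ab_lt0; rewrite -[b]opprK root_sub ?root_opp ?linearNr ?oppr_gt0 //.
by rewrite -addr_eq0.
Qed.

End RootBasics.

(** * Bases from regular functionals *)

Section Bases.
Variables (R : realType) (V : vectType R) (dot : {dot V for @idfun R}).
Implicit Types (u v w a b : V) (D : {fset V}) (f g h : 'Hom(V, R^o)).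

(** All small [t] are allowed so that the bound can shrink as vectors are
    added to [F]. *)
Lemma perturb_pos (F : seq V) f h :
  exists2 e : R, 0 < e &
    forall t : R, 0 < t <= e -> {in F, forall v, 0 < f v -> 0 < (f + t *: h) v}.
Proof.
elim: F => [|v F [e e0 IH]]; first by exists 1.
have [fv0|fv0] := lerP (f v) 0.
  exists e => // t te w; rewrite in_cons => /predU1P[->|]; last exact: IH.
  by rewrite ltNge fv0.
have hv1 : 0 < `|h v| + 1 by rewrite ltr_wpDl.
exists (Num.min e (f v / (`|h v| + 1))); first by rewrite lt_min e0 divr_gt0.
move=> t /andP[t0]; rewrite le_min => /andP[te tf] w.
rewrite in_cons => /predU1P[->|]; last by apply: IH; rewrite t0.
move=> _; rewrite add_lfunE scale_lfunE /= /GRing.scale /=.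
move: tf; rewrite ler_pdivlMr // => tf.
have := ler_norm (- (h v : R)); rewrite normrN => /(ler_wpM2l (ltW t0)).
lra.
Qed.

(** A vector [a] on which the functional vanishes is moved off the kernel by
    adding a small multiple of [dot a], which is positive at [a]; the signs
    already achieved survive. *)
Lemma exists_regular (F s : seq V) f :
    0 \notin F -> {in F, forall a, - a \in F} -> {subset s <= F} ->
  exists g, {in F, forall a, 0 < f a -> 0 < g a} /\ {in s, forall a, g a != 0}.
Proof.
move=> F0 FN; elim: s => [|a s IH] sF; first by exists f; split.
have sF' : {subset s <= F} by move=> b bs; apply: sF; rewrite in_cons bs orbT.
have [g [fg gs]] := IH sF'.
have aF : a \in F by apply: sF; rewrite mem_head.
have [ga0|ga0] := eqVneq (g a) 0; last first.
  by exists g; split=> // b; rewrite in_cons => /predU1P[->|/gs].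
have [e e0 pos] := perturb_pos F g (linfun (dotl dot a)).
have {}pos := pos e; rewrite e0 lexx in pos; have {}pos := pos isT.
exists (g + e *: linfun (dotl dot a)); split=> [b bF fb|b].
  exact/pos/fg.
rewrite in_cons => /predU1P[->|bs].
  rewrite add_lfunE scale_lfunE ga0 add0r lfunE /= scaler_eq0 gt_eqF //=.
  by rewrite gt_eqF // dot_gt0 //; apply: contraNneq F0 => <-.
have bF : b \in F by apply: sF; rewrite in_cons bs orbT.
case: (ltgtP (g b) 0) (gs b bs) => // [gb _|/pos/gt_eqF->//].
by rewrite -oppr_eq0 -linearN gt_eqF // pos ?FN // linearN oppr_gt0.
Qed.

Lemma free_fset D :
  (forall c : V -> R, \sum_(a <- D) c a *: a = 0 -> {in D, forall a, c a = 0}) ->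
  free D.
Proof.
move=> h; rewrite -[_ D]/(val (in_tuple D)); apply/freeP => k k0 i.
pose c' (n : nat) := if insub n is Some j then k j else 0.
have iD : (i < size D)%N by [].
have := h (fun a => c' (index a D)) _ (D`_i) (mem_nth 0 iD).
rewrite index_uniq ?fset_uniq // /c' valK; apply.
rewrite -[RHS]k0 (big_nth 0) big_mkord; apply: eq_bigr => j _ /=.
by rewrite index_uniq ?fset_uniq // /c' valK.
Qed.

(** Split a vanishing combination into its positive and negative parts [u = w]:
    obtuseness forces [dot u w <= 0], so both vanish, and the half-space then
    forces every coefficient to vanish. *)
Lemma obtuse_free D g :
    {in D, forall a, 0 < g a} ->
    {in D &, forall a b, a != b -> dot a b <= 0} ->
  free D.
Proof.
move=> gD obt; apply: free_fset => c c0.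
pose p a : R := Num.max (c a) 0; pose q a : R := Num.max (- c a) 0.
have p_ge0 a : 0 <= p a by rewrite le_max lexx orbT.
have q_ge0 a : 0 <= q a by rewrite le_max lexx orbT.
have cpq a : c a = p a - q a by rewrite /p /q; case: lerP => ca; case: lerP => ca'; lra.
have pq0 a : p a * q a = 0.
  rewrite /p /q; case: lerP => ca; rewrite ?mul0r //.
  case: lerP => ca'; rewrite ?mulr0 //.
  lra.
pose u := \sum_(a <- D) p a *: a; pose w := \sum_(a <- D) q a *: a.
have uw : u = w.
  apply/eqP; rewrite -subr_eq0 -sumrB; apply/eqP; rewrite -[RHS]c0.
  by apply: eq_bigr => a _; rewrite -scalerBl -cpq.
have u0 : u = 0.
  apply/eqP; apply: contraT => /(dot_gt0 dot); rewrite ltNge => /negP[].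
  rewrite {2}uw linear_sumlz big_seq sumr_le0 // => a aD.
  rewrite linear_sumr big_seq sumr_le0 // => b bD.
  rewrite linearZl_LR linearZr_LR /= mulrA.
  have [<-|ab] := eqVneq a b; first by rewrite pq0 mul0r.
  by rewrite mulr_ge0_le0 ?mulr_ge0 ?obt.
have coef0 (r : V -> R) : (forall a, 0 <= r a) -> \sum_(a <- D) r a *: a = 0 ->
    {in D, forall a, r a = 0}.
  move=> r0 /(congr1 g); rewrite linear_sum linear0 => /eqP.
  rewrite big_seq psumr_eq0 => [/allP h a aD|a aD]; last first.
    by rewrite linearZ; apply: mulr_ge0 => //; rewrite ltW ?gD.
  have := h a aD; rewrite aD /= linearZ /= mulf_eq0 => /orP[/eqP //|].
  by rewrite gt_eqF // gD.
move=> a aD; rewrite cpq (coef0 p) ?(coef0 q) ?subr0 // -/w -uw //.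
Qed.

(** Induction on the height [g], which takes finitely many values on [F]. *)
Lemma root_ind (F : {fset V}) g (P : V -> Prop) :
    {in F, forall a, (forall b, b \in F -> g b < g a :> R -> P b) -> P a} ->
  {in F, forall a, P a}.
Proof.
move=> step a; pose below a := [fset b in F | (g b : R) < g a]%fset.
have [n] := ubnP #|` below a|; elim: n a => // n IH a len aF.
apply: step => // b bF gba; apply: IH => //.
apply: leq_trans (_ : #|` below a| <= n)%N; last by rewrite -ltnS.
apply: fproper_ltn_card; rewrite fproperE; apply/andP; split.
  by apply/fsubsetP => c; rewrite !inE /= => /andP[-> /lt_trans->].
by apply/fsubsetPn; exists b; rewrite !inE /= ?bF // ltxx andbF.
Qed.

Variable Phi : {fset V}.
Hypothesis rsPhi : is_root_system dot Phi.

(** The base consists of the [g]-positive roots that are not sums of two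
    [g]-positive roots.  Two of them at an acute angle would differ by a root,
    and one would be the sum of the other and that root. *)
Lemma exists_base g : {in Phi, forall a, g a != 0} ->
  exists2 D, is_base Phi D & {in D, forall a, 0 < g a}.
Proof.
move=> greg.
pose splits a b := [&& 0 < g b, a - b \in Phi & 0 < g (a - b)].
pose D := [fset a in Phi | (0 < g a) && ~~ has (splits a) Phi]%fset.
have DP a : a \in D -> [/\ a \in Phi, 0 < g a & ~~ has (splits a) Phi].
  by rewrite !inE => /and3P.
have gD : {in D, forall a, 0 < g a} by move=> a /DP[].
have pos_span : {in Phi, forall a, 0 < g a -> natspan D a}.
  apply: (root_ind (g := g)) => a aP IH ga.
  have [/hasP[b bP /and3P[gb abP gab]]|nsplit] := boolP (has (splits a) Phi).
    rewrite -[a](subrK b); apply: natspanD; apply: IH => //.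
      by rewrite homB ltrBlDr ltrDl.
    by move: gab; rewrite homB subr_gt0.
  by apply: natspan_gen; rewrite !inE aP ga.
have spanP : {in Phi, forall a, natspan D a \/ natspan D (- a)}.
  move=> a aP; case: (ltgtP (g a) 0) (greg a aP) => // ga _; [right|left].
    by apply: pos_span; [exact: (root_opp rsPhi aP) | rewrite linearN oppr_gt0].
  exact: pos_span.
exists D => //; split=> //; first by apply/fsubsetP=> a /DP[].
apply/andP; split; last first.
  apply: (obtuse_free gD) => a b /DP[aP ga na] /DP[bP gb nb] ab.
  rewrite leNgt; apply/negP => ab_gt0; have abP := root_sub rsPhi aP bP ab ab_gt0.
  case: (ltgtP (g (a - b)) 0) (greg _ abP) => // gab _.
    case/hasP: nb; exists a => //; rewrite /splits ga -[b - a]opprB.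
    by rewrite (root_opp rsPhi) // linearN oppr_gt0.
  by case/hasP: na; exists b; rewrite // /splits gb abP.
have natspan_span v : natspan D v -> v \in <<D>>%VS.
  by case=> c ->; rewrite big_seq rpred_sum // => a aD; rewrite rpredMn ?memv_span.
rewrite eqEsubv subvf /=; have [<- _ _ _ _] := rsPhi.
apply/span_subvP => a aP; case: (spanP a aP) => /natspan_span //.
by rewrite rpredN.
Qed.
End Bases.

(** * Coordinates in a base *)

Section DualBasis.
Variables (R : realType) (V : vectType R).
Implicit Types (u v w a b : V) (D : {fset V}) (f g h : 'Hom(V, R^o)).

(** The coordinate functional of [a] in the basis [D], made total by the
    value 0 for [a] outside [D]. *)
Definition dual D a : 'Hom(V, R^o) :=
  if insub (index a D) is Some i then linfun (coord (in_tuple D) i : V -> R^o) else 0.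

Lemma dualE D a b :
  free D -> a \in D -> b \in D -> dual D a b = (b == a)%:R.
Proof.
move=> fD aD bD; rewrite /dual insubT ?index_mem // => ia /=; rewrite lfunE /=.
have ib : (index b D < size D)%N by rewrite index_mem.
rewrite -{1}(nth_index 0 bD).
rewrite (coord_free (Ordinal ib) (Ordinal ia)) // -val_eqE /=.
congr (nat_of_bool _)%:R; apply/eqP/eqP => [|->//].
by move=> e; rewrite -(nth_index 0 bD) e nth_index.
Qed.

Lemma dual_sum D (x : V -> R) a : free D -> a \in D ->
  dual D a (\sum_(b <- D) x b *: b) = x a.
Proof.
move=> fD aD; rewrite linear_sum (bigD1_seq a) ?fset_uniq //= homZ dualE // eqxx mulr1.
rewrite big_seq_cond big1 ?addr0 // => b /andP[bD /negPf ba].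
by rewrite homZ dualE // ba mulr0.
Qed.

Lemma dual_natsum D (c : V -> nat) a : free D -> a \in D ->
  dual D a (\sum_(b <- D) b *+ c b) = (c a)%:R.
Proof.
move=> fD aD; rewrite -(dual_sum (fun b => (c b)%:R) fD aD); congr (dual D a _).
by apply: eq_bigr => b _; rewrite scaler_nat.
Qed.

Lemma dual_expand D v : basis_of fullv D -> v = \sum_(a <- D) dual D a v *: a.
Proof.
move=> bD; have fD := basis_free bD.
rewrite {1}(@coord_basis _ _ _ _ (in_tuple D) v bD (memvf v)).
rewrite (big_nth 0) big_mkord; apply: eq_bigr => i _; congr (_ *: _).
rewrite /dual index_uniq ?fset_uniq // insubT //= => iD; rewrite lfunE.
by congr (coord _ _ _); apply: val_inj.
Qed.

Lemma natspan_eq0 f D v : {in D, forall a, f a = 0} -> natspan D v -> f v = 0.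
Proof.
move=> f0 [c ->]; rewrite linear_sum big_seq big1 // => a aD.
by rewrite linearMn /= f0 // mul0rn.
Qed.

Lemma natspan_dual_gt0 D v : basis_of fullv D -> natspan D v -> v != 0 ->
  exists2 a, a \in D & (0 < dual D a v).
Proof.
move=> bD Dv v0; have fD := basis_free bD.
have ge0 a : a \in D -> 0 <= dual D a v.
  by move=> aD; apply: natspan_ge0 Dv => b bD'; rewrite dualE.
have [/hasP //|/hasPn no] := boolP (has (fun a => 0 < dual D a v) D).
case/eqP: v0; rewrite (dual_expand v bD) big_seq big1 // => a aD.
have := no a aD; rewrite -leNgt => le0.
by rewrite (@le_anti _ R (dual D a v) 0) ?le0 ?ge0 // scale0r.
Qed.
End DualBasis.

(** * The highest root *)

Section HighestRoot.
Variables (R : realType) (V : vectType R) (dot : {dot V for @idfun R}).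
Implicit Types (u v w a b : V) (f g h : 'Hom(V, R^o)).
Variables Phi D : {fset V}.
Hypotheses (rsPhi : is_root_system dot Phi) (baseD : is_base Phi D).

Let basisD : basis_of fullv D. Proof. by case: baseD. Qed.
Let freeD : free D. Proof. exact: basis_free basisD. Qed.

Lemma base_root a : a \in D -> a \in Phi.
Proof. by case: baseD => /fsubsetP sDP _ _; apply: sDP. Qed.

Lemma base_span a : a \in Phi -> natspan D a \/ natspan D (- a).
Proof. by case: baseD => _ _; apply. Qed.

Lemma dual_ge0 a v : a \in D -> natspan D v -> 0 <= dual D a v.
Proof. by move=> aD; apply: natspan_ge0 => b bD; rewrite dualE. Qed.

(** The difference of two simple roots has coordinates of both signs, so it is
    not a root. *)
Lemma base_obtuse a b : a \in D -> b \in D -> a != b -> dot a b <= 0.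
Proof.
move=> aD bD ab; rewrite leNgt; apply/negP => ab_gt0.
have abP := root_sub rsPhi (base_root aD) (base_root bD) ab ab_gt0.
case: (base_span abP) => [/(dual_ge0 bD)|/(dual_ge0 aD)]; last rewrite opprB.
  by rewrite homB !dualE // eqxx (negPf ab) sub0r oppr_ge0 ler10.
by rewrite homB !dualE // eqxx eq_sym (negPf ab) sub0r oppr_ge0 ler10.
Qed.

Lemma natspan_restrict (P : pred V) (c : V -> nat) :
  natspan [fset a in D | P a]%fset (\sum_(a <- D | P a) a *+ c a).
Proof.
rewrite big_seq_cond; apply: big_ind; [exact: natspan0|exact: natspanD|].
move=> a aDP; elim: (c a) => [|n IH]; first exact: natspan0.
by rewrite mulrS; apply: natspanD IH; apply: natspan_gen; rewrite !inE.
Qed.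

Let ht := \sum_(a <- D) dual D a.

Let htD a : a \in D -> ht a = 1.
Proof.
move=> aD; rewrite sum_lfunE (bigD1_seq a) ?fset_uniq //= dualE // eqxx.
rewrite big_seq_cond big1 ?addr0 // => b /andP[bD ba].
by rewrite dualE // eq_sym (negPf ba).
Qed.

Let ht_gt0 v : natspan D v -> v != 0 -> 0 < ht v.
Proof.
move=> Dv v0; have [a aD av] := natspan_dual_gt0 basisD Dv v0.
rewrite sum_lfunE (bigD1_seq a) ?fset_uniq //= big_seq_cond ltr_wpDr //.
by apply: sumr_ge0 => b /andP[bD _]; exact: dual_ge0.
Qed.

(** If a positive root [b] had support on both sides, some [a] on one side has
    [dot b a > 0]; by induction [b - a] lives on the other side, so the
    reflection of [b] in [a] is [b - 2 a], whose coordinates have mixed signs. *)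
Lemma orthogonal_support (P : pred V) :
    {in D &, forall a b, P a -> ~~ P b -> dot a b = 0} ->
  {in Phi, forall b, natspan D b ->
    natspan [fset a in D | P a]%fset b \/ natspan [fset a in D | ~~ P a]%fset b}.
Proof.
move=> orth; apply: (root_ind (g := ht)) => b bP IH Db.
have [c Ec] := Db.
pose b1 := \sum_(a <- D | P a) a *+ c a.
pose b2 := \sum_(a <- D | ~~ P a) a *+ c a.
have Eb : b = b1 + b2 by rewrite Ec (bigID P).
have N1 : natspan [fset a in D | P a]%fset b1 by exact: natspan_restrict.
have N2 : natspan [fset a in D | ~~ P a]%fset b2 by exact: natspan_restrict.
have [b10|b10] := eqVneq b1 0; first by right; rewrite Eb b10 add0r.
have [b20|b20] := eqVneq b2 0; first by left; rewrite Eb b20 addr0.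
have orth' : {in [fset a in D | ~~ P a]%fset & [fset a in D | P a]%fset,
    forall a a', dot a a' = 0}.
  by move=> a a'; rewrite !inE => /andP[aD Pa] /andP[a'D Pa']; rewrite dotC orth.
have dual_out Q a v : a \in D -> ~~ Q a ->
    natspan [fset a in D | Q a]%fset v -> dual D a v = 0.
  move=> aD Qa; apply: natspan_eq0 => d; rewrite !inE => /andP[dD Qd].
  by rewrite dualE //; have [da|//] := eqVneq d a; rewrite -da Qd in Qa.
have [a2 a2D [Pa2 ba2]] : exists2 a, a \in D & ~~ P a /\ 0 < dual D a b.
  have [/hasP[a aD /andP[Pa ca]]|/hasPn no] :=
    boolP (has (fun a => ~~ P a && (0 < c a)%N) D).
    by exists a => //; split=> //; rewrite Ec dual_natsum // ltr0n.
  case/eqP: b20; rewrite /b2 big_seq_cond big1 // => a /andP[aD Pa].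
  by have := no a aD; rewrite Pa /= lt0n negbK => /eqP->.
have [a1 a1D [Pa1 ba1]] : exists2 a, a \in D & P a /\ 0 < dot b a.
  have [/hasP[a aD /andP[Pa ca]]|/hasPn no] :=
    boolP (has (fun a => P a && (0 < dot b a)) D).
    by exists a.
  have: 0 < dot b1 b1 by exact: dot_gt0.
  suff -> : dot b1 b1 = dot b b1.
    rewrite ltNge => /negP[]; rewrite linear_sumr big_seq_cond.
    apply: sumr_le0 => a /andP[aD Pa].
    by rewrite linearMnr mulrn_wle0 //; have := no a aD; rewrite Pa leNgt.
  by rewrite Eb dotDl (natspan_orthogonal orth' N2 N1) addr0.
have a2P v : natspan D v -> 0 <= dual D a2 v by exact: dual_ge0.
have a21 : dual D a2 a1 = 0 by rewrite dualE //; case: eqVneq Pa2 => // <-; rewrite Pa1.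
have ba1P : b - a1 \in Phi.
  apply: (root_sub rsPhi bP (base_root a1D)) => //.
  by apply: contraTneq ba2 => ->; rewrite a21 ltxx.
have Dba1 : natspan D (b - a1).
  case: (base_span ba1P) => // /a2P; rewrite opprB homB a21 sub0r oppr_ge0.
  by rewrite leNgt ba2.
case: (IH _ ba1P _ Dba1) => [|N1'|N2'].
- by rewrite homB (htD a1D) gtrBl.
- have := dual_out P a2 _ a2D Pa2 N1'.
  by rewrite homB a21 subr0 => e; move: ba2; rewrite e ltxx.
have da1 : dual D a1 b = 1.
  have nPa1 : ~~ ~~ P a1 by rewrite negbK.
  have := dual_out (predC P) a1 _ a1D nPa1 N2'.
  by rewrite homB (dualE freeD a1D a1D) eqxx => /eqP; rewrite subr_eq0 => /eqP.
have ca1 : cartan dot a1 b = 2.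
  rewrite -[b](subrK a1) homD cartan_id; last exact/(root_neq0 rsPhi)/base_root.
  rewrite cartanE (natspan_orthogonal orth' N2') ?mulr0 ?mul0r ?add0r //.
  by apply: natspan_gen; rewrite !inE a1D.
have rP := root_reflection rsPhi (base_root a1D) bP; rewrite ca1 in rP.
case: (base_span rP) => [/(dual_ge0 a1D)|/a2P]; last rewrite opprB.
  by rewrite homB homZ da1 (dualE freeD a1D a1D) eqxx /= mulr1; lra.
by rewrite homB homZ a21; lra.
Qed.

Hypothesis irrPhi : is_irreducible dot Phi.

(** A splitting of the base into orthogonal parts splits [Phi] accordingly,
    by the support property, which irreducibility forbids. *)
Lemma base_connected (P : pred V) :
    {in D &, forall a b, P a -> ~~ P b -> dot a b = 0} ->
  {in D, forall a, P a} \/ {in D, forall a, ~~ P a}.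
Proof.
move=> orth; have [_ irr] := irrPhi.
pose supp Q v := let DQ := [fset a in D | Q a]%fset in natspan DQ v \/ natspan DQ (- v).
pose part Q := [fset b in Phi | `[< supp Q b >]]%fset.
have partD (Q : pred V) a : a \in D -> Q a -> a \in part Q.
  move=> aD Qa; rewrite !inE base_root //=; apply/asboolP; left.
  by apply: natspan_gen; rewrite !inE aD.
have suppU : (part P `|` part (predC P) = Phi)%fset.
  apply/fsetP => b; rewrite !inE -andb_orr; have [bP|//] := boolP (b \in Phi).
  rewrite /=; apply/orP; case: (base_span bP) => Db.
    by case: (orthogonal_support orth bP Db) => h; [left|right]; apply/asboolP; left.
  have bP' := root_opp rsPhi bP.
  by case: (orthogonal_support orth bP' Db) => h; [left|right]; apply/asboolP; right.
have dot0 u v : natspan [fset a in D | P a]%fset u ->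
    natspan [fset a in D | ~~ P a]%fset v -> dot u v = 0.
  apply: natspan_orthogonal => a b; rewrite !inE => /andP[aD Pa] /andP[bD Pb].
  exact: orth.
have [|P0|P0] := irr (part P) (part (predC P)) suppU; last 2 first.
- by right=> a aD; apply/negP => /(partD P a aD); rewrite P0 inE.
- by left=> a aD; apply: contraT => /(partD (predC P) a aD); rewrite P0 inE.
move=> a b; rewrite !inE => /andP[_ /asboolP sa] /andP[_ /asboolP sb].
case: sa => sa; case: sb => sb; have := dot0 _ _ sa sb;
  by rewrite ?linearNl ?linearNr ?linearNr ?opprK => /eqP; rewrite ?oppr_eq0 => /eqP.
Qed.

Definition maximal_root t :=
  t \in Phi /\ {in Phi, forall b, natspan D (b - t) -> b = t}.

Lemma le_maximal_root :
  {in Phi, forall b, exists2 t, maximal_root t & natspan D (t - b)}.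
Proof.
apply: (root_ind (g := - ht)) => a aP IH.
have [maxa|] := pselect {in Phi, forall b, natspan D (b - a) -> b = a}.
  by exists a; rewrite // subrr; apply: natspan0.
move=> /existsNP[b /not_implyP[bP /not_implyP[Dba neq_ba]]].
have [|t maxt Dtb] := IH b bP.
  rewrite !opp_lfunE ltrN2 -subr_gt0 -homB ht_gt0 // subr_eq0; exact/eqP.
by exists t => //; rewrite -[t - a](subrKA b); apply: natspanD.
Qed.

Lemma maximal_root_dominant t a : maximal_root t -> a \in D -> 0 <= dot t a.
Proof.
move=> [tP tmax] aD; have aP := base_root aD; have a0 := root_neq0 rsPhi aP.
have t0 := root_neq0 rsPhi tP.
rewrite leNgt; apply/negP => ta_lt0.
have ta0 : t + a != 0.
  apply: contraTneq ta_lt0 => /eqP; rewrite addr_eq0 => /eqP ta.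
  have /tmax -> // : natspan D (a - t); last by rewrite -leNgt dot_ge0.
  by rewrite ta opprK; apply: natspanD; apply: natspan_gen.
have := tmax _ (root_add rsPhi tP aP ta0 ta_lt0).
rewrite [t + a]addrC addrK => /(_ (natspan_gen aD)) /eqP.
by rewrite -subr_eq0 addrK (negPf a0).
Qed.

Lemma maximal_root_natspan t : maximal_root t -> natspan D t.
Proof.
move=> [tP tmax]; case: (base_span tP) => // DNt.
have := tmax _ (root_opp rsPhi tP) (natspanD DNt DNt).
move/eqP; rewrite eq_sym -addr_eq0 -mulr2n -scaler_nat scaler_eq0 pnatr_eq0 /=.
by rewrite (negPf (root_neq0 rsPhi tP)).
Qed.

(** Each base vector outside the support of [t] has nonpositive products with
    the support, hence is orthogonal to it by dominance: the support is a
    connected component of the base. *)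
Lemma maximal_root_full t a : maximal_root t -> a \in D -> 0 < dual D a t.
Proof.
move=> maxt; have [tP _] := maxt; have Dt := maximal_root_natspan maxt.
have [b bD bt] := natspan_dual_gt0 basisD Dt (root_neq0 rsPhi tP).
have [|all0|none] := @base_connected (fun a => 0 < dual D a t); first last.
- by have := none b bD; rewrite bt.
- exact: all0.
move=> c d cD dD ct dt.
have dt0 : dual D d t = 0.
  by apply: le_anti; rewrite (dual_ge0 dD Dt) leNgt dt.
have td : dot t d = \sum_(e <- D) dual D e t * dot e d.
  rewrite {1}(dual_expand t basisD) dot_suml; apply: eq_bigr => e _.
  by rewrite dotZl.
have term_le0 e : e \in D -> dual D e t * dot e d <= 0.
  move=> eD; have [->|ed] := eqVneq e d; first by rewrite dt0 mul0r.
  by rewrite mulr_ge0_le0 ?base_obtuse // dual_ge0.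
have := maximal_root_dominant maxt dD; rewrite td (bigD1_seq c) ?fset_uniq //=.
have : \sum_(e <- D | e != c) dual D e t * dot e d <= 0.
  by rewrite big_seq_cond sumr_le0 // => e /andP[eD _]; apply: term_le0.
have : dot c d <= 0 by apply: base_obtuse => //; apply: contraTneq ct => ->.
by rewrite le_eqVlt => /orP[/eqP //|cd]; have : dual D c t * dot c d < 0; [nra|lra].
Qed.

(** By dominance and full support, two maximal roots have a positive product,
    so their difference is a root or 0, and one of them lies above the other. *)
Lemma maximal_root_unique t t' : maximal_root t -> maximal_root t' -> t = t'.
Proof.
move=> maxt maxt'; have [tP tmax] := maxt; have [tP' tmax'] := maxt'.
have [//|neq_tt'] := eqVneq t t'.
suff tt'_gt0 : 0 < dot t t'.
  case: (base_span (root_sub rsPhi tP tP' neq_tt' tt'_gt0)) => [/(tmax' _ tP) //|].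
  by rewrite opprB => /(tmax _ tP').
have [a aD at'] : exists2 a, a \in D & 0 < dot t' a.
  have [/hasP //|/hasPn no] := boolP (has (fun a => 0 < dot t' a) D).
  have : 0 < dot t' t' by apply/dot_gt0/(root_neq0 rsPhi).
  have [c {2}->] := maximal_root_natspan maxt'.
  rewrite ltNge linear_sumr big_seq => /negP[]; apply: sumr_le0 => a aD.
  by rewrite linearMnr mulrn_wle0 // leNgt no.
rewrite (dual_expand t basisD) dot_suml (bigD1_seq a) ?fset_uniq //=.
rewrite dotZl [dot a t']dotC ltr_wpDr ?mulr_gt0 ?maximal_root_full //.
rewrite big_seq_cond; apply: sumr_ge0 => b /andP[bD _].
by rewrite dotZl [dot b t']dotC mulr_ge0 ?maximal_root_dominant ?ltW ?maximal_root_full.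
Qed.

Lemma exists_highest_root : exists t, is_highest_root Phi D t.
Proof.
have [/fset0Pn[b bP] _] := irrPhi.
have [t maxt _] := le_maximal_root bP; exists t; split; first by case: maxt.
move=> c cP; have [t' maxt' Dt'c] := le_maximal_root cP.
by rewrite (maximal_root_unique maxt maxt').
Qed.
End HighestRoot.

(** * Translation into the alcove *)

Section Alcove.
Variables (R : realType) (V : vectType R) (dot : {dot V for @idfun R}).
Implicit Types (u v w a b : V) (f g h : 'Hom(V, R^o)).
Variable Phi : {fset V}.
Hypothesis rsPhi : is_root_system dot Phi.

Lemma reflection_perm b : b \in Phi -> perm_eq [seq reflection dot b a | a <- Phi] Phi.
Proof.
move=> bP; have rK := reflectionK dot (root_neq0 rsPhi bP).
apply: uniq_perm; rewrite ?fset_uniq ?map_inj_uniq ?fset_uniq //; first exact: inv_inj.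
move=> a; apply/mapP/idP => [[c cP ->]|aP].
  by rewrite reflectionE (root_reflection rsPhi).
by exists (reflection dot b a); rewrite ?rK // reflectionE (root_reflection rsPhi).
Qed.

(** A quadratic form on functionals that is invariant under the reflections.
    It is used in place of the norm because bounded denominators of [f] on
    [Phi] pass directly to [energy f]. *)
Definition energy f : R := \sum_(a <- Phi) f a ^+ 2.

(** Writing [n] for [cartan b], invariance of the energy under the reflection
    gives [2 sum f n = f b * sum n ^ 2], whence
    [energy (f - n) = energy f + (1 - f b) * sum n ^ 2]. *)
Lemma energy_sub_cartan f b : b \in Phi -> 1 < f b ->
  energy (f - cartan dot b) < energy f.
Proof.
move=> bP fb; set n := cartan dot b.
pose N : R := \sum_(a <- Phi) n a ^+ 2; pose M : R := \sum_(a <- Phi) f a * n a.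
have expand (t : R) :
    \sum_(a <- Phi) (f a - t * n a) ^+ 2 = energy f - 2 * t * M + t ^+ 2 * N.
  rewrite /energy /M /N !mulr_sumr -sumrB -big_split; apply: eq_bigr => a _ /=.
  by ring.
have inv : \sum_(a <- Phi) (f a - f b * n a) ^+ 2 = energy f.
  rewrite /energy -[RHS](perm_big _ (reflection_perm bP)) big_map; apply: eq_bigr => a _.
  by rewrite reflectionE homB homZ mulrC.
have N_gt0 : 0 < N.
  rewrite /N (bigD1_seq b) ?fset_uniq //= cartan_id ?(root_neq0 rsPhi) //.
  by apply: ltr_pwDl; rewrite ?exprn_gt0 // sumr_ge0 // => a _; rewrite sqr_ge0.
have -> : energy (f - n) = energy f - 2 * 1 * M + 1 ^+ 2 * N.
  rewrite -expand; apply: eq_bigr => a _.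
  by rewrite mul1r add_lfunE opp_lfunE.
have fb0 : (f b : R) != 0 by rewrite gt_eqF // (lt_trans _ fb).
have M2 : 2 * M = f b * N.
  by apply: (mulfI fb0); move: inv; rewrite expand; lra.
by rewrite expr1n mul1r mulr1 M2; nra.
Qed.

(** While [f b > 1] for some root [b], subtracting the coroot [cartan b]
    preserves the values on roots modulo integers and lowers the energy.  The
    energy stays in [(1 / e^2) nat], so the process stops. *)
Lemma alcove_translate f (e : nat) : (0 < e)%N ->
    {in Phi, forall a, f a * e%:R \is a Num.int} ->
  exists2 g : 'Hom(V, R^o), {in Phi, forall a, f a - g a \is a Num.int} &
             {in Phi, forall a, g a <= 1}.
Proof.
move=> e0 fe.
have energy_nat g : {in Phi, forall a, g a * e%:R \is a Num.int} ->
    energy g * e%:R ^+ 2 \is a Num.nat.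
  move=> ge; rewrite /energy mulr_suml big_seq rpred_sum // => a aP.
  by rewrite -exprMn natrEint rpredX ?ge //= sqr_ge0.
have /natrP[n En] := energy_nat f fe.
elim/ltn_ind: n f fe En => n IH f fe En.
have [/hasP[b bP fb]|/hasPn f1] := boolP (has (fun b => 1 < f b) Phi); last first.
  by exists f => a aP; [rewrite subrr | rewrite leNgt f1].
have f1e : {in Phi, forall a, (f - cartan dot b) a * e%:R \is a Num.int}.
  move=> a aP; rewrite add_lfunE opp_lfunE mulrBl rpredB ?fe // rpredM //.
    exact: (cartan_int rsPhi).
  exact: rpred_nat.
have /natrP[m Em] := energy_nat _ f1e.
have [|g fg g1] := IH m _ _ f1e Em.
  by rewrite -(ltr_nat R) -Em -En ltr_pM2r ?exprn_gt0 ?ltr0n ?energy_sub_cartan.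
exists g => // a aP; have := fg a aP; rewrite add_lfunE opp_lfunE => h.
rewrite -[f a](subrK (cartan dot b a)) -addrAC rpredD //.
exact: (cartan_int rsPhi).
Qed.
End Alcove.

(** * A character whose order is the exponent *)

Lemma leq_of_div_int (R : archiRealFieldType) (d : int) (k : nat) :
  (0 < k)%N -> d != 0 -> k%:R / d%:~R \is a @Num.int R -> (`|d| <= k)%N.
Proof.
move=> k0 d0 /intrP[q Eq]; have dR : (d%:~R : R) != 0 by rewrite intr_eq0.
have Ek : k = q * d :> int by apply: (@intr_inj R); rewrite intrM -Eq divfK.
by rewrite dvdn_leq //; apply/dvdnP; exists `|q|%N; rewrite -abszM -Ek.
Qed.

(** Integral linear algebra behind the character of maximal order.  The rows
    of [M] generate a sublattice; [d] is its last invariant factor, [c / d] is the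
    character, integral on the sublattice, and [r] is a vector on which it takes
    the value [1 / d].  The matrix [A] says that [e] annihilates the quotient, so
    the sublattice has full rank; [B] says that [d] annihilates it as well,
    because every invariant factor divides the last one. *)
Lemma smith_character m n (M : 'M[int]_(m, n.+1)) (A : 'M[int]_(n.+1, m)) (e : int) :
    e != 0 -> A *m M = e%:M ->
  exists (d : int) (c : 'cV[int]_n.+1) (r : 'rV[int]_n.+1) (B : 'M[int]_(n.+1, m)),
    [/\ d != 0, forall i, (d %| (M *m c)%R i ord0)%Z, r *m c = 1%:M & B *m M = d%:M].
Proof.
move=> e0 AM; have [L Lu [Q Qu [d d_sorted EM]]] := int_Smith_normal_form M.
set Delta := (\matrix_(i, j) _) in EM.
have PD : (Q *m A *m L) *m Delta = e%:M.
  apply: (can_inj (mulmxK Qu)); rewrite -!mulmxA [L *m _]mulmxA -EM AM.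
  exact: scalar_mxC.
have diag (j : 'I_n.+1) : (j < m)%N && (d`_j != 0).
  move/matrixP/(_ j j): PD; rewrite !mxE eqxx mulr1n.
  have [jm|mj] := ltnP j m; last first.
    rewrite big1 => [/eqP|k _]; first by rewrite eq_sym (negPf e0).
    by rewrite !mxE ltn_eqF ?mulr0n ?mulr0 // (leq_trans (ltn_ord k)).
  apply: contra_eqN => /eqP dj0; rewrite big1 ?(eq_sym 0) // => k _.
  by rewrite !mxE; case: eqP => [->|_]; rewrite ?dj0 ?mulr1n ?mulr0n mulr0.
have n_le_m : (n < m)%N by case/andP: (diag ord_max).
have d_neq0 (j : 'I_n.+1) : d`_j != 0 by case/andP: (diag j).
have size_d : (n < size d)%N.
  by rewrite ltnNge; apply/negP => ?; have := d_neq0 ord_max; rewrite /= nth_default ?eqxx.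
have d_dvd (j : 'I_n.+1) : (d`_j %| d`_n)%Z.
  have trans : transitive dvdz by move=> ? ? ?; exact: dvdz_trans.
  have := sorted_leq_nth trans (@dvdzz) 0 d_sorted; apply; rewrite ?inE //.
    by rewrite (leq_ltn_trans _ size_d) // -ltnS.
  by rewrite -ltnS.
exists d`_n, (col ord_max (invmx Q)), (row ord_max Q).
(* [Gamma] multiplies the [i]-th generator by the cofactor of its invariant
   factor in the last one *)
pose Gamma : 'M[int]_(n.+1, m) := \matrix_(i, k) ((d`_n %/ d`_i)%Z *+ (i == k :> nat)).
have GD : Gamma *m Delta = (d`_n)%:M.
  apply/matrixP=> i j; have /andP[im _] := diag i.
  rewrite !mxE (bigD1 (Ordinal im)) //= big1 ?addr0 => [|k /negPf ki].
    by rewrite !mxE /= eqxx mulr1n mulrnAr divzK.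
  by rewrite !mxE eq_sym -val_eqE in ki *; rewrite ki mulr0n mul0r.
exists (invmx Q *m Gamma *m invmx L); split=> [|i||]; first exact: (d_neq0 ord_max).
- rewrite colE mulmxA {1}EM mulmxK // -colE mxE !mxE.
  apply: rpred_sum => k _; rewrite !mxE; case: eqP => [->|_].
    by rewrite mulr1n dvdz_mull.
  by rewrite mulr0n mulr0 dvdz0.
- rewrite rowE colE mulmxA -[_ *m Q *m _]mulmxA mulmxV // mulmx1.
  by apply/matrixP=> i j; rewrite !ord1 -rowE !mxE !eqxx.
- rewrite EM -!mulmxA [invmx L *m _]mulmxA mulVmx // mul1mx [Gamma *m _]mulmxA GD.
  by rewrite -scalar_mxC mulmxA mulVmx // mul1mx.
Qed.

Section Character.
Variables (R : realType) (V : vectType R) (dot : {dot V for @idfun R}).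
Implicit Types (u v w a b : V) (S : {fset V}) (f g h : 'Hom(V, R^o)).
Variables Phi D : {fset V}.
Hypotheses (rsPhi : is_root_system dot Phi) (baseD : is_base Phi D).

Lemma dual_int a b : a \in D -> b \in Phi -> dual D a b \is a Num.int.
Proof.
case: baseD => _ /basis_free fD span aD bP.
case: (span b bP) => -[c]; last (move/(canRL opprK) => ->; rewrite homN rpredN).
  by move=> ->; rewrite dual_natsum // rpred_nat.
by rewrite dual_natsum // rpred_nat.
Qed.

Lemma hom_int f S v : {in S, forall a, f a \is a Num.int} -> v \in intspan S ->
  f v \is a Num.int.
Proof.
move=> fS /intspanP[z ->]; rewrite linear_sum big_seq rpred_sum // => a aS.
by rewrite raddfMz /= rpredMz ?fS.
Qed.

(** If [k f] is integral on roots then [k / d] is an integer, [d] being the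
    last invariant factor, which annihilates the quotient: this bounds [e] by [k]. *)
Lemma exists_character S e :
    (S `<=` Phi)%fset -> Phi != fset0 -> is_exponent (lattice_quot Phi S) e ->
  exists f, {in S, forall a, f a \is a Num.int} /\
    forall k : nat, (0 < k)%N -> {in Phi, forall a, f a * k%:R \is a Num.int} ->
      (e <= k)%N.
Proof.
move=> /fsubsetP sSPhi Phi0 [e_gt0 /lattice_quot_annulP annul_e min_e].
have [sDP basisD spanD] := baseD; have freeD := basis_free basisD.
have DP := fsubsetP sDP.
have [n szD] : exists n, size D = n.+1.
  case E : (size D) => [|n]; last by exists n.
  have [b bP] := fset0Pn _ Phi0.
  case/negP: (root_neq0 rsPhi bP); rewrite (dual_expand b basisD).
  by move/size0nil: E => ->; rewrite big_nil.
have Dj (j : 'I_n.+1) : D`_j \in D by rewrite mem_nth ?szD.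
have sumD (W : zmodType) (F : V -> W) : \sum_(a <- D) F a = \sum_(j < n.+1) F D`_j.
  by rewrite (big_nth 0) szD big_mkord.
have sumS (W : zmodType) (F : V -> W) : \sum_(a <- S) F a = \sum_(i < size S) F S`_i.
  by rewrite (big_nth 0) big_mkord.
have Si (i : 'I_(size S)) : S`_i \in S by rewrite mem_nth.
pose M : 'M[int]_(size S, n.+1) := \matrix_(i, j) Num.floor (dual D D`_j S`_i).
have ME i j : (M i j)%:~R = dual D D`_j S`_i :> R.
  by rewrite mxE floorK // dual_int // sSPhi.
pose vec (r : 'rV[int]_n.+1) := \sum_(j < n.+1) D`_j *~ r 0 j.
have SE (i : 'I_(size S)) : S`_i = \sum_(j < n.+1) D`_j *~ M i j.
  rewrite {1}(dual_expand S`_i basisD) sumD; apply: eq_bigr => j _.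
  by rewrite -ME scaler_int.
have vecM (z : 'rV_(size S)) : vec (z *m M) \in intspan S.
  rewrite (_ : vec _ = \sum_(i < size S) S`_i *~ z 0 i).
    by apply: rpred_sum => i _; rewrite rpredMz ?intspan_gen ?Si.
  under [RHS]eq_bigr => i _ do rewrite SE mulrz_suml.
  rewrite exchange_big; apply: eq_bigr => j _; rewrite mxE mulrz_sumr.
  by apply: eq_bigr => i _; rewrite mulrC mulrzA.
have rowA (j : 'I_n.+1) : exists z : 'rV[int]_(size S), z *m M = e%:Z *: delta_mx 0 j.
  have /intspanP[z Ez] := annul_e _ (DP _ (Dj j)).
  exists (\row_i z S`_i); apply/rowP => k; apply: (@intr_inj R).
  rewrite !mxE eqxx /= rmorphM rmorph_sum /=.
  have := congr1 (dual D D`_k) Ez; rewrite homMn (dualE freeD (Dj k) (Dj j)).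
  rewrite sumS linear_sum /= nth_uniq ?szD ?fset_uniq // eq_sym => E.
  transitivity (\sum_(i < size S) dual D D`_k (S`_i *~ z S`_i)); last first.
    by rewrite -E -[LHS]mulr_natl rmorph_nat -pmulrn.
  by apply: eq_bigr => i _; rewrite [X in X * _]mxE rmorphM /= ME raddfMz /= mulrzl.
have [A AM] := fin_all_exists rowA.
have AM' : (\matrix_j A j) *m M = (e%:Z)%:M.
  by apply/row_matrixP => j; rewrite row_mul rowK AM -scalemx1 linearZ /= row1.
have e0 : e%:Z != 0 by rewrite -lt0n.
have [d [c [r [B [d0 dM rc BM]]]]] := smith_character e0 AM'.
pose f : 'Hom(V, R^o) := \sum_(j < n.+1) ((c j 0)%:~R / d%:~R : R) *: dual D D`_j.
have fD (j : 'I_n.+1) : f D`_j = (c j 0)%:~R / d%:~R :> R.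
  rewrite sum_lfunE (bigD1 j) //= big1 => [|k /negPf kj].
    by rewrite scale_lfunE (dualE freeD (Dj j) (Dj j)) eqxx addr0; exact: mulr1.
  rewrite scale_lfunE (dualE freeD (Dj k) (Dj j)) nth_uniq ?szD ?fset_uniq //.
  by rewrite eq_sym (_ : (k == j :> nat) = false) ?scaler0.
have dR0 : d%:~R != 0 :> R by rewrite intr_eq0.
exists f; split=> [s sS|k k0 fk].
  have i_lt : (index s S < size S)%N by rewrite index_mem.
  pose i := Ordinal i_lt; have Es : s = S`_i by rewrite nth_index.
  rewrite Es SE linear_sum /=; have /dvdzP[q Eq] := dM i.
  rewrite (_ : \sum_j _ = q%:~R) ?intr_int //.
  apply: (mulIf dR0); rewrite -intrM -Eq mxE rmorph_sum mulr_suml.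
  by apply: eq_bigr => j _; rewrite raddfMz /= fD rmorphM /= -mulrzl -mulrA divfK.
have kd : k%:R / d%:~R \is a @Num.int R.
  have := congr1 (fun X : 'M[int]_1 => (X 0 0)%:~R : R) rc.
  rewrite !mxE eqxx /= => rc1.
  rewrite -[k%:R]mulr1 -[X in _ * X / _]rc1 rmorph_sum mulr_sumr mulr_suml.
  apply: rpred_sum => j _; rewrite rmorphM /= mulrCA -mulrA rpredM ?intr_int //.
  by have := fk _ (DP _ (Dj j)); rewrite fD mulrC mulrA.
have dk := leq_of_div_int k0 d0 kd.
apply: leq_trans dk; apply: min_e; first by rewrite absz_gt0.
apply/lattice_quot_annulP => a aP.
have ad : a *~ d \in intspan S.
  pose r0 := \row_(j < n.+1) Num.floor (dual D D`_j a).
  rewrite (_ : a *~ d = vec (r0 *m B *m M)) ?vecM //.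
  rewrite -mulmxA BM mul_mx_scalar {1}(dual_expand a basisD) sumD mulrz_suml.
  apply: eq_bigr => j _; rewrite !mxE mulrC mulrzA; congr (_ *~ _).
  rewrite -scaler_int floorK //.
  exact: dual_int.
by rewrite pmulrn abszE; case: (ger0P d) => _; rewrite ?mulrNz ?rpredN.
Qed.
End Character.

(** * Exponents and coefficients of the highest root *)

Section Exponents.
Variables (R : realType) (V : vectType R) (dot : {dot V for @idfun R}).
Implicit Types (u v w a b t : V) (S D : {fset V}) (f g h : 'Hom(V, R^o)).
Variable Phi : {fset V}.
Hypothesis rsPhi : is_root_system dot Phi.

Lemma hom_span_eq0 f S v : <<S>>%VS = fullv -> {in S, forall s, f s = 0} -> f v = 0.
Proof.
move=> fullS f0; apply/eqP; rewrite -memv_ker; apply: subvP (memvf v).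
by rewrite -fullS; apply/span_subvP => s sS; rewrite memv_ker f0.
Qed.

Lemma highest_root_natspan D t :
  is_base Phi D -> is_highest_root Phi D t -> natspan D t.
Proof.
move=> baseD [tP high]; case: (base_span baseD tP) => // DNt.
rewrite -[t](subKr (t + t)) addrK; apply: natspanD DNt.
by have := high _ (root_opp rsPhi tP); rewrite opprK.
Qed.

Lemma highest_root_dual_ge1 D t a : is_base Phi D -> is_highest_root Phi D t ->
  a \in D -> 1 <= dual D a t.
Proof.
move=> baseD [tP high] aD; have := dual_ge0 baseD aD (high _ (base_root baseD aD)).
have [_ /basis_free fD _] := baseD.
by rewrite homB (dualE fD aD aD) eqxx subr_ge0.
Qed.

(** The extended simple system with [a] removed generates a sublattice of
    cyclic quotient: [t] replaces [a], and [t] is [c a] times [a] modulo the other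
    simple roots. *)
Lemma highest_coeff_exponent D t (c : V -> nat) a :
    is_base Phi D -> is_highest_root Phi D t ->
    t = \sum_(b <- D) b *+ c b -> a \in D ->
  exponents Phi (c a).
Proof.
move=> baseD high Et aD; have [tP _] := high; have [sDP basisD spanD] := baseD.
have fD := basis_free basisD.
have ca0 : (0 < c a)%N.
  have := highest_root_dual_ge1 baseD high aD.
  by rewrite Et dual_natsum // (ler_nat R 1).
pose S : {fset V} := (t |` (D `\ a))%fset.
have tS : t \in S by rewrite !inE eqxx.
have bS b : b \in D -> b != a -> b \in S by rewrite !inE => -> ->; rewrite orbT.
have Ea : a *+ c a = t - \sum_(b <- D | b != a) b *+ c b.
  by rewrite Et (bigD1_seq a) ?fset_uniq //= addrK.
exists S; split.
- apply/fsubsetP => b; rewrite !inE => /predU1P[->//|/andP[_]].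
  exact: base_root.
- apply/eqP; rewrite eqEsubv subvf /=; case/andP: basisD => /eqP <- _.
  apply/span_subvP => b bD; have [->|ba] := eqVneq b a; last by rewrite memv_span ?bS.
  have cR : (c a)%:R != 0 :> R by rewrite pnatr_eq0 -lt0n.
  rewrite -[a](scalerK cR) scaler_nat Ea memvZ // memvB ?(memv_span tS) //.
  rewrite big_seq_cond rpred_sum // => x /andP[xD xa].
  by rewrite rpredMn ?memv_span ?bS.
split=> //; first apply/lattice_quot_annulP.
- have annulD b : b \in D -> b *+ c a \in intspan S.
    move=> bD; have [->|ba] := eqVneq b a; last by rewrite rpredMn ?intspan_gen ?bS.
    rewrite Ea rpredB ?(intspan_gen tS) // big_seq_cond rpred_sum // => x /andP[xD xa].
    by rewrite rpredMn ?intspan_gen ?bS.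
  have annulN b : natspan D b -> b *+ c a \in intspan S.
    move=> [d ->]; rewrite -sumrMnl big_seq rpred_sum // => x xD.
    by rewrite -mulrnA mulnC mulrnA rpredMn ?annulD.
  by move=> b /spanD[/annulN //|/annulN]; rewrite mulNrn rpredN.
move=> k k0 /lattice_quot_annulP/(_ a (base_root baseD aD)) akS.
pose f : 'Hom(V, R^o) := ((c a)%:R^-1 : R) *: dual D a.
have cR : (c a)%:R != 0 :> R by rewrite pnatr_eq0 -lt0n.
have fS : {in S, forall s, f s \is a @Num.int R}.
  move=> s; rewrite !inE scale_lfunE => /predU1P[->|/andP[sa sD]].
    by rewrite Et dual_natsum // /GRing.scale /= mulVf.
  by rewrite (dualE fD aD sD) (negPf sa) scaler0.
rewrite -[c a]absz_nat; apply: (@leq_of_div_int R) => //.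
  by rewrite -lt0n.
have := hom_int fS akS.
by rewrite homMn scale_lfunE (dualE fD aD aD) eqxx /GRing.scale /= mulr1 mulr_natl.
Qed.

Lemma exponent1 : exponents Phi 1%N.
Proof.
have [full _ _ _ _] := rsPhi; exists Phi; split=> //; split=> //.
by apply/lattice_quot_annulP => a aP; rewrite mulr1n intspan_gen.
Qed.

Hypothesis irrPhi : is_irreducible dot Phi.

(** A regular functional that is positive wherever [g] is defines the base; on
    roots where it is positive, [g] cannot be negative. *)
Lemma regular_base g : exists2 D, is_base Phi D & {in D, forall a, 0 <= g a}.
Proof.
have Phi0 : 0 \notin Phi by case: rsPhi.
have [h [gh hreg]] := exists_regular dot g Phi0 (root_opp rsPhi) (fun a aP => aP).
have [D baseD hD] := exists_base rsPhi hreg.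
exists D => // a aD; rewrite leNgt; apply/negP => ga.
have aP := base_root baseD aD.
have : 0 < h (- a) by apply: gh; rewrite ?(root_opp rsPhi) // homN oppr_gt0.
by rewrite homN oppr_gt0 ltNge ltW ?hD.
Qed.

(** A sum of nonnegative terms [dual D b v * g b] vanishes only termwise. *)
Lemma natspan_support g D v a : is_base Phi D -> {in D, forall b, 0 <= g b} ->
  natspan D v -> g v = 0 -> a \in D -> 0 < g a -> dual D a v = 0.
Proof.
move=> baseD gD Dv gv aD ga; have [_ basisD _] := baseD.
have ge0 b : b \in D -> 0 <= dual D b v by move=> bD; apply: (dual_ge0 baseD).
move: gv; rewrite (dual_expand v basisD) linear_sum (bigD1_seq a) ?fset_uniq //= homZ.
rewrite -(dual_expand v basisD) => /eqP.
rewrite paddr_eq0; last 2 first.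
- by rewrite mulr_ge0 ?ge0 ?ltW.
- by rewrite big_seq_cond sumr_ge0 // => b /andP[bD _]; rewrite homZ mulr_ge0 ?ge0 ?gD.
by rewrite mulf_eq0 (gt_eqF ga) orbF => /andP[/eqP].
Qed.

(** The two possibilities for a point [g] of the closed fundamental alcove such
    that the roots with integral value on [g] span: the origin, or a vertex
    [omega_a / c a] other than the origin. *)
Lemma alcove_vertex g S D t : is_base Phi D -> is_highest_root Phi D t ->
    {in D, forall a, 0 <= g a} -> g t <= 1 ->
    (S `<=` Phi)%fset -> <<S>>%VS = fullv -> {in S, forall s, g s \is a Num.int} ->
  (forall v, g v = 0) \/
  exists2 a, a \in D & dual D a t * g a = 1 /\ {in D, forall b, b != a -> g b = 0}.
Proof.
move=> baseD high gD gt1 /fsubsetP sSP fullS gS; have [tP hight] := high.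
have [_ basisD spanD] := baseD; have fD := basis_free basisD.
have Dt := highest_root_natspan baseD high.
have gN v : natspan D v -> 0 <= g v by apply: natspan_ge0.
have le_t b : b \in Phi -> g b <= g t.
  by move=> bP; have := gN _ (hight b bP); rewrite homB subr_ge0.
(* enough to look at roots of [S] up to sign *)
have wlogS (h : 'Hom(V, R^o)) : (forall b, b \in Phi -> natspan D b ->
    g b \is a @Num.int R -> h b = 0) -> forall v, h v = 0.
  move=> h0 v; apply: (@hom_span_eq0 h S v fullS) => s sS; have sP := sSP s sS.
  have [Ds|DNs] := spanD s sP; first by apply: h0; rewrite ?gS.
  apply/eqP; rewrite -oppr_eq0 -linearN; apply/eqP; apply: h0 => //.
    exact: (root_opp rsPhi).
  by rewrite homN rpredN gS.
have int01 (x : R) : x \is a Num.int -> 0 <= x -> x <= 1 -> x = 0 \/ x = 1.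
  move=> /intrP[z ->]; rewrite ler0z (ler_int R z 1) => z0 z1.
  have [->|->] : z = 0 \/ z = 1 by lia.
    by left.
  by right.
have [gt|gt] := ltP (g t : R) 1.
  left; apply: wlogS => b bP Db gb.
  have [//|gb1] := int01 _ gb (gN _ Db) (le_trans (le_t b bP) gt1).
  by have := le_lt_trans (le_t b bP) gt; rewrite gb1 ltxx.
have {}gt : g t = 1 :> R by apply/le_anti; rewrite gt1.
right; have [/hasP[a aD ga]|/hasPn g0] := boolP (has (fun a => 0 < g a) D); last first.
  have /eqP : g t = 0; last by rewrite gt oner_eq0.
  apply: (natspan_eq0 (f := g)) Dt => a aD; apply/le_anti.
  by rewrite gD // andbT leNgt g0.
have g0 b : b \in D -> b != a -> g b = 0.
  move=> bD ba; apply/eqP; apply: contraT => gb0.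
  have gb : 0 < g b by rewrite lt_def gb0 gD.
  (* [h] kills [t] and the simple roots killed by [g], hence all of [S] *)
  pose h : 'Hom(V, R^o) := (dual D b t : R) *: dual D a - (dual D a t : R) *: dual D b.
  have hE v : h v = dual D b t * dual D a v - dual D a t * dual D b v :> R.
    by rewrite add_lfunE opp_lfunE !scale_lfunE.
  have h0 : forall v, h v = 0.
    apply: wlogS => x xP Dx gx; rewrite hE.
    have [gx0|gx1] := int01 _ gx (gN _ Dx) (le_trans (le_t x xP) gt1).
      by rewrite !(natspan_support baseD gD Dx gx0) // !mulr0 subrr.
    have gtx : g (t - x) = 0 by rewrite homB gt gx1 subrr.
    have same y : y \in D -> 0 < g y -> dual D y x = dual D y t.
      move=> yD gy; have := natspan_support baseD gD (hight x xP) gtx yD gy.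
      by rewrite homB => /eqP; rewrite subr_eq0 => /eqP.
    by rewrite !same // mulrC subrr.
  have := h0 a; rewrite hE (dualE fD aD aD) (dualE fD bD aD) eqxx.
  rewrite eq_sym (negPf ba) mulr0 subr0 mulr1 => /eqP.
  by rewrite gt_eqF // (lt_le_trans ltr01) // (highest_root_dual_ge1 baseD high).
exists a => //; split=> //; rewrite -gt {2}(dual_expand t basisD) linear_sum.
rewrite (bigD1_seq a) ?fset_uniq //= homZ big_seq_cond big1 ?addr0 // => b /andP[bD ba].
by rewrite homZ g0 ?mulr0.
Qed.

(** A character of order [e] is moved to the alcove, where it is a vertex
    [omega_a / c a] of order [c a] or the origin of order 1. *)
Lemma exponent_coeff e : exponents Phi e -> highest_coeffs Phi e \/ e = 1%N.
Proof.
move=> [S [sSP fullS expS]]; have [e_gt0 annul_e _] := expS.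
have [D0 baseD0 _] := regular_base 0.
have [f [fS forder]] := exists_character rsPhi baseD0 sSP irrPhi.1 expS.
have fe : {in Phi, forall a, f a * e%:R \is a @Num.int R}.
  move=> a aP; rewrite mulr_natr -homMn; apply: (hom_int fS).
  by move/lattice_quot_annulP: annul_e; apply.
have [g fg g1] := alcove_translate rsPhi e_gt0 fe.
have int_fg k : {in Phi, forall a, g a * k%:R \is a @Num.int R} <->
                {in Phi, forall a, f a * k%:R \is a @Num.int R}.
  split=> h a aP; have := rpredM (fg a aP) (rpred_nat _ k); rewrite mulrBl => hk.
    by rewrite -[_ * _](subrK (g a * k%:R)) rpredD ?h.
  by rewrite -[_ * _](subKr (f a * k%:R)) rpredB ?h.
have gS : {in S, forall s, g s \is a @Num.int R}.
  move=> s sS; rewrite -[g s](subKr (f s)) rpredB ?fS ?fg //.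
  exact: (fsubsetP sSP).
have [D baseD gD] := regular_base g.
have [t high] := exists_highest_root rsPhi baseD irrPhi.
have [tP _] := high; have [_ basisD spanD] := baseD; have fD := basis_free basisD.
have [g0|[a aD [ga g0]]] := alcove_vertex baseD high gD (g1 t tP) sSP fullS gS.
  right; apply/eqP; rewrite eqn_leq e_gt0 andbT; apply: forder => //.
  by apply/int_fg => a _; rewrite g0 mul0r.
left; have [c Ec] := highest_root_natspan baseD high.
exists D, t, c; split=> //; exists a => //.
rewrite {1}Ec dual_natsum // in ga.
have ca0 : (0 < c a)%N.
  by case: (c a) ga => //; rewrite mul0r => /eqP; rewrite eq_sym oner_eq0.
have gaE : g a = (c a)%:R^-1 :> R.
  by apply: (mulfI (x := (c a)%:R)); rewrite ?ga ?mulfV // pnatr_eq0 -lt0n.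
apply/eqP; rewrite eqn_leq; apply/andP; split.
  apply: forder => //; apply/int_fg => b bP.
  have gint x : x \in D -> g x * (c a)%:R \is a @Num.int R.
    by move=> xD; have [->|/g0->//] := eqVneq x a; rewrite ?mul0r // mulrC ga.
  have gintN v : natspan D v -> g v * (c a)%:R \is a @Num.int R.
    move=> [d ->]; rewrite linear_sum mulr_suml big_seq rpred_sum // => x xD.
    by rewrite raddfMn /= mulrnAl rpredMn ?gint.
  by have [/gintN //|/gintN] := spanD b bP; rewrite homN mulNr rpredN.
rewrite -[c a]absz_nat; apply: (@leq_of_div_int R) => //; first by rewrite -lt0n.
rewrite mulrC -[_%:~R^-1]gaE.
by have /int_fg := fe; apply; apply: (base_root baseD).
Qed.
End Exponents.

Theorem proposition1p7 (R : realType) (V : vectType R)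
    (dot : {dot V for @idfun R}%R) (Phi : {fset V}) :
  is_root_system dot Phi -> is_irreducible dot Phi ->
  exponents Phi = (highest_coeffs Phi `|` [set 1%N])%classic.
Proof.
move=> rsPhi irrPhi; apply/seteqP; split=> e.
  by move/(exponent_coeff rsPhi irrPhi).
case=> [[D [t [c [baseD high Et [a aD ->]]]]]|->]; last exact: exponent1 rsPhi.
exact: (highest_coeff_exponent baseD high Et aD).
Qed.
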